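(* Let $(X,\mathcal U)$ be a quasi-uniform space. Then the $T_0$-quotient $(qS_D(X),q\mathcal U_D)$ of $(S_D(X),\mathcal U_D)$ is the bicompletion of its subspace $q\mathcal C\mathcal P_0(X):=\{\mathcal D_{\mathcal U}(\mathcal C_C): C\in\mathcal P_0(X),\ C \text{ is doubly closed in } (X,\mathcal U)\}$. (Here $qS_D(X)$ is identified with the set of all doubly stable $2$-round filters on $(X,\mathcal U)$, equipped with the restriction $q\mathcal U_D$ of $\mathcal U_D$.)
   Context: A quasi-uniformity on $X$ is a filter $\mathcal U$ on $X\times X$ whose members all contain the diagonal and such that each $U\in\mathcal U$ admits $V\in\mathcal U$ with $V^2=V\circ V\subseteq U$. Write $U(x)=\{y:(x,y)\in U\}$, $U(A)=\bigcup_{x\in A}U(x)$; $\tau(\mathcal U)$ is the topology in which $\{U(x):U\in\mathcal U\}$ is the neighborhood filter of $x$. $\mathcal U^{-1}=\{U^{-1}:U\in\mathcal U\}$ is the conjugate quasi-uniformity and $\mathcal U^s$ is the coarsest uniformity finer than $\mathcal U$ (generated by $U^s=U\cap U^{-1}$, $U\in\mathcal U$). $(X,\mathcal U)$ is bicomplete if the uniformity $\mathcal U^s$ is complete, and is a $T_0$-space if $\tau(\mathcal U)$ is $T_0$. A bicompletion of a quasi-uniform $T_0$-space is a (unique up to quasi-uniform isomorphism) bicomplete quasi-uniform $T_0$-space $(Y,\mathcal V)$ containing it as a $\tau(\mathcal V^s)$-dense quasi-uniform subspace. Points $x,y$ are $\mathcal U$-equivalent if $(x,y)\in\bigcap\mathcal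 U\cap\bigcap\mathcal U^{-1}$; the $T_0$-quotient is represented by any subspace meeting each equivalence class in exactly one point. $\mathcal P_0(X)$ is the set of nonempty subsets of $X$. A set $C\subseteq X$ is doubly closed in $(X,\mathcal U)$ if $C=\mathrm{cl}_{\tau(\mathcal U)}C\cap\mathrm{cl}_{\tau(\mathcal U^{-1})}C$. For $C\in\mathcal P_0(X)$, $\mathcal C_C$ denotes the filter on $X$ generated by $\{C\}$. A filter $\mathcal F$ on $X$ is doubly stable if for each $U\in\mathcal U$ the set $U_{\mathcal F}:=\bigcap_{F\in\mathcal F}(U^{-1}(F)\cap U(F))$ belongs to $\mathcal F$. The $2$-envelope $\mathcal D_{\mathcal U}(\mathcal F)$ of a filter $\mathcal F$ is the filter generated by $\{U^{-1}(F)\cap U(F):F\in\mathcal F,U\in\mathcal U\}$; $\mathcal F$ is $2$-round if $\mathcal F=\mathcal D_{\mathcal U}(\mathcal F)$. $S_D(X)$ is the set of all doubly stable filters on $(X,\mathcal U)$. For $U\in\mathcal U$ let $U_+=\{(\mathcal F,\mathcal G)\in S_D(X)^2:\bigcap_{F\in\mathcal F}U(F)\in\mathcal G\}$, $U_-=\{(\mathcal F,\mathcal G)\in S_D(X)^2:\bigcap_{G\in\mathcal G}U^{-1}(G)\in\mathcal F\}$, $U_D=U_+\cap U_-$. The stability quasi-uniformity $\mathcal U_D$ on $S_D(X)$ is the one with base $\{U_D:U\in\mathcal U\}$. Every doubly stable filter is $\mathcal U_D$-equivalent to exactly one doubly stable $2$-round filter, namely its $2$-envelope. *)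

(* Defs.v *)
From HB Require Import structures.
From mathcomp Require Import all_boot.
From mathcomp Require Import all_classical.
From mathcomp Require Import topology.

Set Implicit Arguments.
Unset Strict Implicit.
Unset Printing Implicit Defensive.

Local Open Scope classical_set_scope.
Local Open Scope relation_scope.

(* [Filter] rather than [ProperFilter] only matters for an empty carrier: as
   soon as X is inhabited, the diagonal axiom makes the filter proper. *)
Record quasiUniformity (X : Type) := QuasiUniformity {
  qent : set_system (X * X);
  #[global] qent_filter :: Filter qent;
  qent_diagonal : forall V, qent V -> diagonal `<=` V;
  qent_split_ex : forall V, qent V -> exists2 W, qent W & W \; W `<=` V }.


Definition rel_image (X : Type) (V : set (X * X)) (A : set X) : set X :=
  \bigcup_(x in A) xsection V x.

Lemma rel_imageP (X : Type) (V : set (X * X)) (A : set X) y :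
  rel_image V A y <-> exists2 x, A x & V (x, y).
Proof.
split=> [[x Ax /xsectionP Vxy]|[x Ax Vxy]]; first by exists x.
by exists x => //; apply/xsectionP.
Qed.

Lemma qent_refl (X : Type) (U : quasiUniformity X) V x : qent U V -> V (x, x).
Proof. by move=> /qent_diagonal; apply. Qed.

Section Conjugate.
Context (X : Type) (U : quasiUniformity X).

Let conj := [set V^-1 | V in qent U].

Let conj_filter : Filter conj. Proof. exact: filter_inv. Qed.

Let conj_diagonal V : conj V -> diagonal `<=` V.
Proof. by case=> W UW <- [x y] /= xy; rewrite (xy : x = y); exact: (qent_refl _ UW). Qed.

Let conj_split_ex V : conj V -> exists2 W, conj W & W \; W `<=` V.
Proof.
case=> W /qent_split_ex[W' UW' W'W] <-; exists (W'^-1); first by exists W'.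
by move=> [x y] /= [z /= ? ?]; apply: W'W; exists z.
Qed.

Definition qconj : quasiUniformity X :=
  QuasiUniformity conj_filter conj_diagonal conj_split_ex.

End Conjugate.

(* The carrier X with the topology tau(U). *)
Definition qtop (X : Type) (U : quasiUniformity X) : Type := X.

Section QTop.
Context (X : Type) (U : quasiUniformity X).

HB.instance Definition _ := gen_eqMixin (qtop U).
HB.instance Definition _ := gen_choiceMixin (qtop U).
HB.instance Definition _ := hasNbhs.Build (qtop U) (nbhs_ (qent U)).

Let qnbhs_filter (p : qtop U) : ProperFilter (nbhs p).
Proof.
apply: filter_from_proper; last first.
  by move=> A UA; exists p; apply/xsectionP; exact: (qent_refl _ UA).
apply: filter_from_filter; first by exists setT; exact: filterT.
by move=> A B UA UB; exists (A `&` B); [exact: filterI|rewrite xsectionI].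
Qed.

Let qnbhs_singleton (p : qtop U) A : nbhs p A -> A p.
Proof. by case=> B UB; apply; apply/xsectionP; exact: (qent_refl _ UB). Qed.

Let qnbhs_nbhs (p : qtop U) A : nbhs p A -> nbhs p (nbhs^~ A).
Proof.
case=> B /qent_split_ex[C UC sCB] sBA; exists C => // q /xsectionP Cpq.
exists C => // r /xsectionP Cqr.
by apply/sBA/xsectionP/sCB; exists q.
Qed.

HB.instance Definition _ := Nbhs_isNbhsTopological.Build (qtop U)
  qnbhs_filter qnbhs_singleton qnbhs_nbhs.

End QTop.

(* The carrier X with the uniformity U^s. *)
Definition qsym (X : Type) (U : quasiUniformity X) : Type := X.

Section QSym.
Context (X : Type) (U : quasiUniformity X).

Let sym := filter_from (qent U) (fun V => V `&` V^-1).

Let sym_filter : Filter sym.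
Proof.
apply: filter_from_filter; first by exists setT; exact: filterT.
move=> V W UV UW; exists (V `&` W); first exact: filterI.
by move=> [x y] /= [[? ?] [? ?]].
Qed.

Let sym_diagonal V : sym V -> diagonal `<=` V.
Proof.
case=> W UW WV [x y] xy; apply: WV; rewrite (xy : x = y).
by split; exact: (qent_refl _ UW).
Qed.

Let sym_inv V : sym V -> sym V^-1.
Proof. by case=> W UW WV; exists W => // -[x y] [/= ? ?]; apply: WV. Qed.

Let sym_split_ex V : sym V -> exists2 W, sym W & W \; W `<=` V.
Proof.
case=> W /qent_split_ex[W' UW' W'W] WV; exists (W' `&` W'^-1).
  by exists W'.
move=> [x y] [z /= [? ?] [? ?]]; apply: WV.
by split; apply: W'W; exists z.
Qed.

HB.instance Definition _ := gen_eqMixin (qsym U).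
HB.instance Definition _ := gen_choiceMixin (qsym U).
HB.instance Definition _ := isUniform.Build (qsym U)
  sym_filter sym_diagonal sym_inv sym_split_ex.

End QSym.

(* [completeType] and [cvg F] would require a pointed carrier, and the spaces
   of interest may be empty. *)
Definition bicomplete (X : Type) (U : quasiUniformity X) : Prop :=
  forall F : set_system (qsym U),
    ProperFilter F -> cauchy F -> exists x : qsym U, F --> x.

Definition qT0 (X : Type) (U : quasiUniformity X) : Prop :=
  kolmogorov_space (qtop U).

Section Subspace.
Context (X : Type) (U : quasiUniformity X) (A : set X).

Let trace := filter_from (qent U) (fun V : set (X * X) =>
  [set p : A * A | V (\val p.1, \val p.2)]).

Let trace_filter : Filter trace.
Proof.
apply: filter_from_filter; first by exists setT; exact: filterT.
by move=> V W UV UW; exists (V `&` W); first exact: filterI.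
Qed.

Let trace_diagonal V : trace V -> diagonal `<=` V.
Proof. by case=> W UW WV [x y] xy; apply: WV; rewrite (xy : x = y); exact: (qent_refl _ UW). Qed.

Let trace_split_ex V : trace V -> exists2 W, trace W & W \; W `<=` V.
Proof.
case=> W /qent_split_ex[W' UW' W'W] WV.
exists [set p : A * A | W' (\val p.1, \val p.2)]; first by exists W'.
by move=> [x y] [z /= ? ?]; apply: WV; apply: W'W; exists (\val z).
Qed.

Definition qsub : quasiUniformity A :=
  QuasiUniformity trace_filter trace_diagonal trace_split_ex.

End Subspace.

Definition qembedding (X Y : Type) (U : quasiUniformity X)
    (V : quasiUniformity Y) (i : X -> Y) : Prop :=
  injective i /\
  qent U = filter_from (qent V) (fun W => [set p | W (i p.1, i p.2)]).

(* (Y, V), together with i : X -> Y, is a bicompletion of (X, U).  Being T0,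
   (X, U) is unconstrained here: this follows from the T0 axiom for (Y, V). *)
Definition bicompletion (X Y : Type) (U : quasiUniformity X)
    (V : quasiUniformity Y) (i : X -> Y) : Prop :=
  [/\ qT0 V, bicomplete V, qembedding U V i &
      dense (range i : set (qsym V))].

Definition qequiv (X : Type) (U : quasiUniformity X) (x y : X) : Prop :=
  ((\bigcap_(V in qent U) V) `&` (\bigcap_(V in qent (qconj U)) V)) (x, y).

(* The subspace A represents the T0-quotient of (X, U). *)
Definition T0_quotient (X : Type) (U : quasiUniformity X) (A : set X) : Prop :=
  forall x, exists! y, A y /\ qequiv U x y.

Section Stability.
Context (X : Type) (U : quasiUniformity X).

Definition doubly_closed (C : set X) : Prop :=
  C = closure (C : set (qtop U)) `&` closure (C : set (qtop (qconj U))).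

Definition double_image (V : set (X * X)) (F : set X) : set X :=
  rel_image V^-1 F `&` rel_image V F.

(* Filters are proper, i.e. do not contain the empty set. *)
Definition doubly_stable (F : set_system X) : Prop :=
  ProperFilter F /\ forall V, qent U V -> F (\bigcap_(A in F) double_image V A).

(* [filter_from] yields the generated filter: when F is a filter, the sets
   [double_image V A] form a filter base. *)
Definition envelope2 (F : set_system X) : set_system X :=
  filter_from [set p : set X * set (X * X) | F p.1 /\ qent U p.2]
    (fun p => double_image p.2 p.1).

Definition round2 (F : set_system X) : Prop := F = envelope2 F.

Definition SD : set (set_system X) := [set F | doubly_stable F].

Definition stab_plus (V : set (X * X)) : set (SD * SD) :=
  [set p | (\val p.2) (\bigcap_(A in \val p.1) rel_image V A)].

Definition stab_minus (V : set (X * X)) : set (SD * SD) :=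
  [set p | (\val p.1) (\bigcap_(A in \val p.2) rel_image V^-1 A)].

Definition stab_ent (V : set (X * X)) : set (SD * SD) :=
  stab_plus V `&` stab_minus V.

Let stab := filter_from (qent U) stab_ent.

Let SD_proper (F : SD) : ProperFilter (\val F).
Proof. by case: (set_valP F). Qed.

Let rel_imageS (V W : set (X * X)) (A : set X) :
  V `<=` W -> rel_image V A `<=` rel_image W A.
Proof.
by move=> VW y /rel_imageP[x Ax Vxy]; apply/rel_imageP; exists x => //; exact: VW.
Qed.

Let stab_entS (V W : set (X * X)) : V `<=` W -> stab_ent V `<=` stab_ent W.
Proof.
move=> VW [F G] [/= FG GF]; have PF := SD_proper F; have PG := SD_proper G.
split=> /=; [apply: filterS FG|apply: filterS GF] => x Vx A FA.
  by apply: rel_imageS VW _ _; exact: Vx.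
by have := Vx A FA; apply: rel_imageS => -[a b]; exact: VW.
Qed.

Let stab_filter : Filter stab.
Proof.
apply: filter_from_filter; first by exists setT; exact: filterT.
move=> V W UV UW; exists (V `&` W); first exact: filterI.
by move=> p pVW; split; apply: stab_entS pVW => q [].
Qed.

Let stab_diagonal V : stab V -> diagonal `<=` V.
Proof.
case=> W UW WV [F G] FG; apply: WV; rewrite (FG : F = G); have PG := SD_proper G.
have [_ /(_ W UW) sG] := set_valP G.
by split => /=; apply: filterS sG => x Wx A GA; case: (Wx A GA).
Qed.

Let stab_split_ex V : stab V -> exists2 W, stab W & W \; W `<=` V.
Proof.
case=> W /qent_split_ex[W' UW' W'W] WV; exists (stab_ent W'); first by exists W'.
move=> [F H] [G [/= FG GF] [/= GH HG]]; apply: WV.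
have PF := SD_proper F; have PH := SD_proper H.
split=> /=; [apply: filterS GH|apply: filterS GF] => x.
  move=> /(_ _ FG)/rel_imageP[z Wz zx] A FA; apply/rel_imageP.
  by have /rel_imageP[a Aa az] := Wz A FA; exists a => //; apply: W'W; exists z.
move=> /(_ _ HG)/rel_imageP[z Wz zx] A FA; apply/rel_imageP.
by have /rel_imageP[a Aa az] := Wz A FA; exists a => //; apply: W'W; exists z.
Qed.

Definition stability : quasiUniformity SD :=
  QuasiUniformity stab_filter stab_diagonal stab_split_ex.

Definition qSD : set SD := [set F : SD | round2 (\val F)].

Definition qstability : quasiUniformity qSD := qsub stability qSD.

Definition principal_envelope (C : set X) : set_system X :=
  envelope2 (globally C).

Definition qCP0 : set qSD :=
  [set F : qSD | exists C : set X,
    [/\ C !=set0, doubly_closed C &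
        \val (\val F) = principal_envelope C]].

(* No principal envelope is lost by carving [qCP0] out of the type [qSD]. *)
Lemma principal_envelope_doubly_stable (C : set X) :
  C !=set0 -> doubly_stable (principal_envelope C).
Proof.
move=> [c Cc].
have sub V A : qent U V -> C `<=` A -> A `<=` double_image V A.
  move=> UV CA x Ax; split; apply/rel_imageP; exists x => //; exact: (qent_refl _ UV).
have imS V (A B : set X) : A `<=` B -> double_image V A `<=` double_image V B.
  move=> AB x [/rel_imageP[y ? ?] /rel_imageP[z ? ?]].
  by split; apply/rel_imageP; [exists y|exists z] => //; exact: AB.
split=> [|V UV].
  apply: filter_from_proper => [|[A V] /= [CA UV]]; last first.
    by exists c; apply: sub => //; exact: CA.
  apply: filter_from_filter; first by exists (setT, setT); split=> //; exact: filterT.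
  move=> [A V] [B W] /= [CA UV] [CB UW]; exists (C, V `&` W).
    by split=> //=; exact: filterI.
  move=> x [/rel_imageP[y Cy [? ?]] /rel_imageP[z Cz [? ?]]] /=.
  by split; split; apply/rel_imageP; [exists y|exists z|exists y|exists z];
    by [|exact: CA|exact: CB].
exists (C, V) => //= x Cx A [[B W] /= [CB UW] BWA].
by apply: imS Cx; apply: subset_trans BWA; apply: subset_trans (sub _ _ UW CB).
Qed.

Lemma principal_envelope_round2 (C : set X) :
  C !=set0 -> round2 (principal_envelope C).
Proof.
move=> C0; apply/seteqP; split=> A; last first.
  have [PF _] := principal_envelope_doubly_stable C0.
  case=> -[B V] /= [FB UV] BVA; apply: filterS BVA _.
  apply: filterS FB => x Bx.
  by split; apply/rel_imageP; exists x => //; exact: (qent_refl _ UV).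
case=> -[B V] /= [CB UV] BVA.
have [W UW WV] := qent_split_ex UV.
exists (double_image W B, W) => /=; first by split=> //; exists (B, W).
apply: subset_trans BVA => x.
move=> [/rel_imageP[y [/rel_imageP[y1 ? ?] _] ?]].
move=> /rel_imageP[z [_ /rel_imageP[z1 ? ?]] ?].
by split; apply/rel_imageP; [exists y1|exists z1] => //; apply: WV;
  [exists y|exists z].
Qed.

End Stability.

Arguments qSD {X} U.
Arguments qCP0 {X} U.

(* Main.v *)
Require Import Defs.
From mathcomp Require Import all_boot all_classical topology.

(** Two filters are close in the uniformity generated by the stability
    quasi-uniformity exactly when each one contains the [V]-core
    [\bigcap_(A in F) (V^-1(A) `&` V(A))] of the other.  The 2-envelope of a doubly
    stable filter F contains its cores, hence is equivalent to F, and a 2-round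
    filter is contained in every filter equivalent to it.  A Cauchy filter Phi
    of doubly stable filters converges to its limit inferior, the filter of the
    sets A such that Phi-almost all F contain A.  Finally, the principal filter
    of the V-core of F is V-close to F, and has the same 2-envelope as that of
    the double closure of this core. *)

Set Implicit Arguments.
Unset Strict Implicit.
Unset Printing Implicit Defensive.

Local Open Scope classical_set_scope.
Local Open Scope relation_scope.

(** * Double images and cores *)

Section DoubleImage.
Context {X : Type}.
Implicit Types (V W : set (X * X)) (A B : set X) (F G : set_system X).

Lemma double_imageS V W A B :
  V `<=` W -> A `<=` B -> double_image V A `<=` double_image W B.
Proof.
move=> VW AB x [/rel_imageP[y Ay Vyx] /rel_imageP[z Az Vzx]].
by split; apply/rel_imageP; [exists y|exists z]; try exact: AB; exact: VW.
Qed.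

Lemma double_image_comp V W A :
  W \; W `<=` V -> double_image W (double_image W A) `<=` double_image V A.
Proof.
move=> WV x [/rel_imageP[y [/rel_imageP[y1 ? ?] _] ?]].
move=> /rel_imageP[z [_ /rel_imageP[z1 ? ?]] ?].
by split; apply/rel_imageP; [exists y1|exists z1] => //; apply: WV;
  [exists y|exists z].
Qed.

Lemma sub_double_image (U : quasiUniformity X) V A :
  qent U V -> A `<=` double_image V A.
Proof.
by move=> UV x Ax; split; apply/rel_imageP; exists x => //; exact: (qent_refl _ UV).
Qed.

(** The set $U_{\mathcal F}$ for the entourage [V]: double stability of [F] says that all its cores
    belong to [F]. *)
Definition double_core V F : set X := \bigcap_(A in F) double_image V A.

Lemma double_coreS V F G : F `<=` G -> double_core V G `<=` double_core V F.
Proof. by move=> FG x Gx A FA; apply/Gx/FG. Qed.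

Lemma double_coreSl V W F : V `<=` W -> double_core V F `<=` double_core W F.
Proof. by move=> VW x Fx A FA; apply: double_imageS VW _ _ (Fx A FA). Qed.

Lemma double_image_core V W F : W \; W `<=` V ->
  double_image W (double_core W F) `<=` double_core V F.
Proof.
move=> WV x Wx A FA; apply: (double_image_comp WV).
by apply: double_imageS Wx => // y; apply.
Qed.

(** The [W]-core of [F] is one of the members of [G] whose double images are intersected in the core
    of [G]. This is the triangle inequality behind the compositions of closeness below. *)
Lemma double_core_trans V W F G : W \; W `<=` V ->
  G (double_core W F) -> double_core W G `<=` double_core V F.
Proof. by move=> WV GF x /(_ _ GF); exact: double_image_core. Qed.

Lemma double_core_globally V A : double_core V (globally A) = double_image V A.
Proof.
apply/seteqP; split=> [x|x Ax B AB]; first by apply.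
exact: double_imageS (@subset_refl _ V) AB _ Ax.
Qed.

End DoubleImage.

Section StabilityTheory.
Context {X : Type} (U : quasiUniformity X).
Implicit Types (V W : set (X * X)) (A B C : set X) (F G : set_system X).

Lemma envelope2_double_image F V A :
  qent U V -> F A -> envelope2 U F (double_image V A).
Proof. by move=> UV FA; exists (A, V). Qed.

Lemma envelope2_sub F : Filter F -> envelope2 U F `<=` F.
Proof.
move=> FF A [[B V] /= [FB UV] BA]; apply: filterS FB.
exact: subset_trans (sub_double_image UV) BA.
Qed.

Lemma envelope2_filter F : Filter F -> Filter (envelope2 U F).
Proof.
move=> FF; apply: filter_from_filter.
  by exists (setT, setT); split=> /=; exact: filterT.
move=> [A V] [B W] /= [FA UV] [FB UW]; exists (A `&` B, V `&` W) => /=.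
  by split; exact: filterI.
by move=> x ABx; split; apply: double_imageS ABx => ? [].
Qed.

Lemma envelope2_proper F : ProperFilter F -> ProperFilter (envelope2 U F).
Proof.
move=> PF; apply: Build_ProperFilter_ex; last exact: envelope2_filter.
by move=> A EA; exact: filter_ex (envelope2_sub _ EA).
Qed.

(** By stability the [W]-core is in [F]; its double [W]-image is then in the envelope and stays
    inside the [V]-core. *)
Lemma envelope2_double_core F V :
  doubly_stable U F -> qent U V -> envelope2 U F (double_core V F).
Proof.
move=> [PF sF] UV; have [W UW WV] := qent_split_ex UV.
have := envelope2_double_image UW (sF W UW).
by apply: filterS; [exact: envelope2_filter|exact: double_image_core].
Qed.

(** The envelope is a smaller filter, so its cores are larger than those of [F], which it already
    contains. *)
Lemma envelope2_doubly_stable F :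
  doubly_stable U F -> doubly_stable U (envelope2 U F).
Proof.
move=> dF; have [PF _] := dF; have PE := envelope2_proper PF.
split=> // V UV; have := envelope2_double_core dF UV.
by apply: filterS; apply: double_coreS; exact: envelope2_sub.
Qed.

Lemma envelope2_round2 F : Filter F -> round2 U (envelope2 U F).
Proof.
move=> FF; have FE := envelope2_filter FF.
apply/seteqP; split; last exact: envelope2_sub.
move=> A [[B V] /= [FB UV] BA]; have [W UW WV] := qent_split_ex UV.
exists (double_image W B, W) => /=; first by split=> //; exact: envelope2_double_image.
exact: subset_trans (double_image_comp WV) BA.
Qed.

(** * Symmetric closeness and the T0-quotient *)

Lemma SD_stable (F : SD U) : doubly_stable U (\val F).
Proof. exact: set_valP. Qed.

Lemma SD_proper (F : SD U) : ProperFilter (\val F).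
Proof. by case: (SD_stable F). Qed.

Definition mkSD F (dF : doubly_stable U F) : SD U := exist _ F (mem_set dF).

Definition SD_close V (F G : SD U) : Prop :=
  (\val G) (double_core V (\val F)) /\ (\val F) (double_core V (\val G)).

Lemma SD_closeC V (F G : SD U) : SD_close V F G -> SD_close V G F.
Proof. by case. Qed.

(** The plus half for (F, G) and the minus half for (G, F) both put a set into [G]; the intersection
    of these two sets is the core of [F]. *)
Lemma stab_ent_sym V (F G : SD U) :
  stab_ent V (F, G) /\ stab_ent V (G, F) <-> SD_close V F G.
Proof.
have PF := SD_proper F; have PG := SD_proper G.
split=> [[[p m] [p' m']]|[FG GF]].
  move: p m p' m' => /= p m p' m'.
  by split; [apply: filterS (filterI p m')|apply: filterS (filterI p' m)];
    move=> x [px mx] A FA; split; [exact: mx|exact: px|exact: mx|exact: px].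
split; split=> /=; [move: FG|move: GF|move: GF|move: FG];
  by apply: filterS => x h A FA; case: (h A FA).
Qed.

Lemma SD_close_comp V W (F G H : SD U) : W \; W `<=` V ->
  SD_close W F G -> SD_close W G H -> SD_close V F H.
Proof.
have PF := SD_proper F; have PH := SD_proper H.
move=> WV [FG GF] [GH HG]; split.
  by apply: filterS GH; exact: double_core_trans.
by apply: filterS GF; exact: double_core_trans.
Qed.

Lemma qequiv_stabilityP (F G : SD U) :
  qequiv (stability U) F G <-> forall V, qent U V -> SD_close V F G.
Proof.
split=> [[FG GF] V UV|FG].
  apply/stab_ent_sym; split; first by apply: FG; exists V.
  by apply: (GF (stab_ent V)^-1); exists (stab_ent V) => //; exists V.
split=> [S [V UV VS]|_ [S [V UV VS] <-]]; apply: VS;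
  by have /stab_ent_sym[] := FG V UV.
Qed.

(** By roundness each member of [F] contains some [double_image V B] with [B] in [F], hence the
    [V]-core of [F], which belongs to [G]. *)
Lemma round2_sub (F G : SD U) : round2 U (\val F) ->
  (forall V, qent U V -> SD_close V F G) -> \val F `<=` \val G.
Proof.
have PG := SD_proper G.
move=> rF FG A; rewrite rF => -[[B V] /= [FB UV] BA].
have [GV _] := FG V UV; apply: filterS GV => x /(_ B FB); exact: BA.
Qed.

Definition SD_envelope2 (F : SD U) : SD U :=
  mkSD (envelope2_doubly_stable (SD_stable F)).

Lemma SD_envelope2_close V (F : SD U) : qent U V -> SD_close V F (SD_envelope2 F).
Proof.
have PF := SD_proper F.
move=> UV; split; first exact: envelope2_double_core (SD_stable F) UV.
have [_ /(_ V UV)] := SD_stable F.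
by apply: filterS; apply: double_coreS; exact: envelope2_sub.
Qed.

Lemma SD_envelope2_qSD (F : SD U) : qSD U (SD_envelope2 F).
Proof. have PF := SD_proper F; exact: envelope2_round2. Qed.

Definition qSD_envelope2 (F : SD U) : qSD U :=
  exist _ (SD_envelope2 F) (mem_set (SD_envelope2_qSD F)).

Lemma qSD_close_eq (F G : qSD U) :
  (forall V, qent U V -> SD_close V (\val F) (\val G)) -> F = G.
Proof.
move=> FG; apply/val_inj/val_inj/seteqP; split.
  by apply: round2_sub FG; exact: (set_valP F).
apply: round2_sub; first exact: (set_valP G).
by move=> V UV; apply/SD_closeC/FG.
Qed.

Lemma T0_quotient_stability : T0_quotient (stability U) (qSD U).
Proof.
move=> F; exists (SD_envelope2 F); split.
  split; first exact: SD_envelope2_qSD.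
  by apply/qequiv_stabilityP => V; exact: SD_envelope2_close.
move=> G [rG /qequiv_stabilityP FG].
pose qG : qSD U := exist _ G (mem_set rG).
suff /(congr1 val) : qSD_envelope2 F = qG by [].
apply: qSD_close_eq => V UV.
have [W UW WV] := qent_split_ex UV.
apply: SD_close_comp WV _ (FG W UW).
exact/SD_closeC/SD_envelope2_close.
Qed.

Lemma qstability_T0 : qT0 (qstability U).
Proof.
move=> F G /eqP FG; apply: contrapT => nFG; apply: FG; apply: qSD_close_eq => V UV.
pose S := [set p : qSD U * qSD U | stab_ent V (\val p.1, \val p.2)].
have entS : qent (qstability U) S by exists (stab_ent V) => //; exists V.
have nbhsS (H : qtop (qstability U)) : nbhs H (xsection S H) by exists S.
(* If one direction failed, the section of [S] at one of the two filters would be a neighborhood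
   missing the other. *)
apply/stab_ent_sym; split; apply: contrapT => nV; apply: nFG.
  by exists (xsection S F); left; split; rewrite inE //; move/xsectionP.
by exists (xsection S G); right; split; rewrite inE //; move/xsectionP.
Qed.

Lemma entourage_qstabilityP (S : set (qsym (qstability U) * qsym (qstability U))) :
  entourage S <-> exists2 V, qent U V &
    forall F G : qSD U, SD_close V (\val F) (\val G) -> S (F, G).
Proof.
split=> [[R [R' [V UV VR'] R'R] RS]|[V UV VS]].
  exists V => // F G /stab_ent_sym[FG GF].
  by apply: RS; split; apply: R'R; exact: VR'.
exists [set p : qSD U * qSD U | stab_ent V (\val p.1, \val p.2)].
  by exists (stab_ent V) => //; exists V.
by move=> [F G] [/= FG GF]; apply: VS; apply/stab_ent_sym.
Qed.

(** * Bicompleteness *)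

Section Bicomplete.
Context (Phi : set_system (qsym (qstability U))).
Context (PPhi : ProperFilter Phi) (cPhi : cauchy Phi).

Definition liminf_filter : set_system X :=
  [set A | Phi [set F : qSD U | \val (\val F) A]].

Lemma liminf_proper : ProperFilter liminf_filter.
Proof.
apply: Build_ProperFilter_ex => [A LA|].
  have [F FA] := @filter_ex _ Phi _ _ LA.
  by have PF := SD_proper (\val F); exact: filter_ex FA.
split=> [|A B LA LB|A B AB LA].
- apply: (@filterS _ Phi _ setT) filterT => F _; have PF := SD_proper (\val F); exact: filterT.
- apply: (@filterS _ Phi) (@filterI _ Phi _ _ _ LA LB) => F [FA FB].
  by have PF := SD_proper (\val F); exact: filterI.
- apply: (@filterS _ Phi) LA => F FA.
  by have PF := SD_proper (\val F); exact: filterS FA.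
Qed.

Lemma cauchy_SD_close V : qent U V -> exists2 P : set (qSD U), Phi P &
  forall F G : qSD U, P F -> P G -> SD_close V (\val F) (\val G).
Proof.
move=> UV; have /cPhi : entourage
    [set p : qsym (qstability U) * qsym (qstability U) |
      SD_close V (\val (p.1 : qSD U)) (\val (p.2 : qSD U))].
  by apply/entourage_qstabilityP; exists V.
case=> -[P Q] /= [PP PQ] PQV; exists (P `&` Q); first exact: filterI.
by move=> F G [PF _] [_ QG]; exact: (PQV (F, G)).
Qed.

(** The [W]-core of an [F] in [P] lies in every [G] in [P], hence in the limit inferior. Since [P]
    depends on [V] only, this already gives convergence up to closeness. *)
Lemma liminf_close V : qent U V -> exists2 P : set (qSD U), Phi P &
  forall F : qSD U, P F -> liminf_filter (double_core V (\val (\val F))) /\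
                   \val (\val F) (double_core V liminf_filter).
Proof.
move=> UV; have [W UW WV] := qent_split_ex UV.
have [P PhiP PW] := cauchy_SD_close UW; exists P => // F PF.
have fF := SD_proper (\val F).
have LF : liminf_filter (double_core W (\val (\val F))).
  by apply: (@filterS _ Phi) PhiP => G PG; case: (PW F G PF PG).
have WV' : W `<=` V by move=> [x y] Wxy; apply: WV; exists x => //; exact: (qent_refl _ UW).
have PL := liminf_proper.
split; first by apply: filterS LF; exact: double_coreSl.
have [_ /(_ W UW)] := SD_stable (\val F); apply: filterS => x Fx B LB.
(* [B] lies in some [G] close to [F]; then the core of [G] belongs to [F]. *)
have [G [PG GB]] := filter_ex (filterI PhiP LB).
have [FG _] := PW G F PG PF; exact: (double_core_trans WV FG Fx).
Qed.

(** A single [F] close to the limit inferior suffices: its [W]-core is in the limit inferior and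
    lies inside the [V]-core of the latter. *)
Lemma liminf_doubly_stable : doubly_stable U liminf_filter.
Proof.
have PL := liminf_proper; split=> // V UV; have [W UW WV] := qent_split_ex UV.
have [P PhiP PW] := liminf_close UW; have [F PF] := filter_ex PhiP.
have [LF FL] := PW F PF; by apply: filterS LF; exact: double_core_trans.
Qed.

Lemma cauchy_cvg_liminf :
  Phi --> (qSD_envelope2 (mkSD liminf_doubly_stable) : qsym (qstability U)).
Proof.
set L := mkSD _; move=> A /nbhsP[S /entourage_qstabilityP[V UV VS] SA].
have [W UW WV] := qent_split_ex UV; have [P PhiP PW] := liminf_close UW.
apply: filterS PhiP => F PF; apply/SA/xsectionP/VS.
(* The limit has to be 2-round, so one [W] is spent between [L] and its envelope, the other between
   [L] and [F]. *)
apply: SD_close_comp WV _ _; first exact/SD_closeC/(SD_envelope2_close L UW).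
by have [LF FL] := PW F PF.
Qed.

End Bicomplete.

Lemma qstability_bicomplete : bicomplete (qstability U).
Proof.
move=> Phi PPhi cPhi.
by exists (qSD_envelope2 (mkSD (liminf_doubly_stable PPhi cPhi))); exact: cauchy_cvg_liminf.
Qed.

(** * Density of the envelopes of doubly closed sets *)

Definition double_closure C : set X :=
  closure (C : set (qtop U)) `&` closure (C : set (qtop (qconj U))).

Lemma double_closureS C : C `<=` double_closure C.
Proof. by move=> x Cx; split; exact: subset_closure. Qed.

Lemma double_closure_closed C : doubly_closed U (double_closure C).
Proof.
apply/seteqP; split=> [|x [cx dx]]; first exact: double_closureS.
by split; [apply: closed_closure; move: cx|apply: closed_closure; move: dx];
  apply: closure_subset => y [].
Qed.

(** The halves cross over: for x in the closure for [U], the section of [V] at x meets [C], which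
    puts x into the image of [C] under [V^-1]; the conjugate closure gives the image under [V]. *)
Lemma double_closure_sub C V : qent U V -> double_closure C `<=` double_image V C.
Proof.
move=> UV x [cx dx]; split; apply/rel_imageP.
  have [|y [Cy /xsectionP Vxy]] := cx (xsection V x); first by exists V.
  by exists y.
have [|y [Cy /xsectionP Vxy]] := dx (xsection V^-1 x); last by exists y.
by exists V^-1 => //; exists V.
Qed.

Lemma principal_envelope_double_closure C :
  principal_envelope U (double_closure C) = principal_envelope U C.
Proof.
have mon (A B : set X) : A `<=` B -> globally B `<=` globally A.
  by move=> AB D BD; exact: subset_trans AB BD.
apply/seteqP; split=> A [[B V] /= [CB UV] BVA].
  by exists (B, V) => //; split=> //; exact: (mon _ _ (@double_closureS C)).
have [W UW WV] := qent_split_ex UV.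
(* [B] contains [C] but perhaps not its double closure; the double [W]-image of [C] does, and leaves
   one more [W] to spend. *)
exists (double_image W C, W) => /=.
  by split=> //; exact: double_closure_sub.
apply: subset_trans BVA => x /(double_image_comp WV).
by apply: double_imageS.
Qed.

Lemma globally_doubly_stable C : C !=set0 -> doubly_stable U (globally C).
Proof.
move=> [c Cc]; split; first exact: globally_properfilter Cc.
move=> V UV; rewrite -/(double_core V (globally C)) double_core_globally.
by move=> x Cx; exact: (sub_double_image UV).
Qed.

(** The core of [globally C] is the double image of [C], which contains [C] and so belongs to [F];
    the other half is [C] itself. *)
Lemma double_core_close V (F : SD U) (C := double_core V (\val F))
    (C0 : C !=set0) : qent U V -> SD_close V F (mkSD (globally_doubly_stable C0)).
Proof.
have PF := SD_proper F.
move=> UV; split=> //=; rewrite double_core_globally.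
have [_ /(_ V UV)] := SD_stable F; apply: filterS => x Cx; exact: (sub_double_image UV).
Qed.

Lemma qCP0_dense : dense (range (set_val : qCP0 U -> qsym (qstability U))).
Proof.
move=> O [F OF] oO; have /nbhsP[S] : nbhs F O by exact: open_nbhs_nbhs.
move=> /entourage_qstabilityP[V UV VS] SO.
have [W UW WV] := qent_split_ex UV; pose C := double_core W (\val (\val (F : qSD U))).
have C0 : C !=set0.
  have PF := SD_proper (\val (F : qSD U)).
  by have [_ /(_ W UW)/filter_ex] := SD_stable (\val (F : qSD U)).
pose E := qSD_envelope2 (mkSD (globally_doubly_stable C0)).
have qE : qCP0 U E.
  (* [C] may fail to be doubly closed, but its double closure has the same envelope. *)
  exists (double_closure C); split; last by rewrite principal_envelope_double_closure.
    exact: (subset_nonempty (@double_closureS C) C0).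
  exact: double_closure_closed.
exists E; split; last by exists (exist _ E (mem_set qE)).
apply/SO/xsectionP/VS; apply: SD_close_comp WV _ _.
  exact: double_core_close.
exact: SD_envelope2_close.
Qed.

End StabilityTheory.

Theorem theorem1 (X : Type) (U : quasiUniformity X) :
  T0_quotient (stability U) (qSD U) /\
  bicompletion (qsub (qstability U) (qCP0 U)) (qstability U)
    set_val.
Proof.
split; first exact: T0_quotient_stability.
split; [exact: qstability_T0|exact: qstability_bicomplete| |exact: qCP0_dense].
(* Entourages of a subspace are traces by definition, which leaves only injectivity. *)
by split=> //; exact: val_inj.
Qed.
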